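(* Let $n>m$ and let $A$ and $B$ be two $m$-subspaces of $\mathbb{Z}_{p^s}^n$. Then $\mathrm{ad}(A,B)=\mathrm{ad}(A^\perp,B^\perp)$.
   Context: $p$ is a prime, $s\ge1$, $R=\mathbb{Z}_{p^s}$; vectors are row vectors. A set $\{\alpha_1,\dots,\alpha_k\}\subseteq R^n$ is unimodular if the matrix with rows $\alpha_i$ has a right inverse. For a submodule $V$, $\dim(V)$ is the largest size of a unimodular subset. A $k$-subspace is a submodule with a unimodular basis of $k$ vectors; it is identified with a matrix whose rows form such a basis, and $\begin{pmatrix}X\\ Y\end{pmatrix}$ stacks representations. Inner rank $\rho(M)$: least $r$ with $M=CD$, $C$ having $r$ columns ($\rho(0)=0$). Arithmetic distance: $\mathrm{ad}(X,Y)=\rho\begin{pmatrix}X\\ Y\end{pmatrix}-\max\{\dim(X),\dim(Y)\}$. Dual: $P^\perp=\{y\in R^n: y\,{}^tx=0\ \forall x\in P\}$, which is an $(n-m)$-subspace when $P$ is an $m$-subspace. *)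

(* Defs.v *)
From HB Require Import structures.
From mathcomp Require Import all_boot all_order all_algebra.

Set Implicit Arguments.
Unset Strict Implicit.
Unset Printing Implicit Defensive.

Import GRing.Theory.
Local Open Scope ring_scope.

Section Defs.
Variable R : finComNzRingType.

Definition unimodular_mx k n (X : 'M[R]_(k, n)) : bool :=
  [exists N : 'M[R]_(n, k), X *m N == 1%:M].

Definition set_mx n (S : {set 'rV[R]_n}) : 'M[R]_(#|S|, n) :=
  \matrix_(i < #|S|) enum_val i.

Definition unimodular n (S : {set 'rV[R]_n}) : bool := unimodular_mx (set_mx S).

Definition dim n (V : {set 'rV[R]_n}) : nat :=
  (\max_(S : {set 'rV[R]_n} | (S \subset V) && unimodular S) #|S|)%N.

Definition row_basis k n (X : 'M[R]_(k, n)) (V : {set 'rV[R]_n}) : bool :=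
  injectiveb (fun u : 'rV[R]_k => u *m X)
  && (V == [set u *m X | u : 'rV[R]_k]).

Definition represents k n (X : 'M[R]_(k, n)) (V : {set 'rV[R]_n}) : bool :=
  unimodular_mx X && row_basis X V.

Definition subspace n (k : nat) (V : {set 'rV[R]_n}) : Prop :=
  submod_closed V /\ exists X : 'M[R]_(k, n), represents X V.

Lemma inner_rank_ex k n (M : 'M[R]_(k, n)) :
  exists r, [exists C : 'M[R]_(k, r), [exists D : 'M[R]_(r, n), M == C *m D]].
Proof.
by exists k; apply/existsP; exists 1%:M; apply/existsP; exists M; rewrite mul1mx.
Qed.

(* The factorization through r = 0 makes the inner rank of 0 equal to 0. *)
Definition inner_rank k n (M : 'M[R]_(k, n)) : nat := ex_minn (inner_rank_ex M).

(* A representation of V, picked among the matrices with dim V rows; the      *)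
(* default 0 only occurs when V is not a subspace (see repr_mxP).             *)
Definition repr_mx n (V : {set 'rV[R]_n}) : 'M[R]_(dim V, n) :=
  odflt 0 [pick X : 'M[R]_(dim V, n) | represents X V].

(* By adE, the value does not depend on the picked representations; it is an  *)
(* int so that the subtraction is not truncated.                              *)
Definition ad n (V W : {set 'rV[R]_n}) : int :=
  (inner_rank (col_mx (repr_mx V) (repr_mx W)))%:Z - (maxn (dim V) (dim W))%:Z.

Definition dual n (P : {set 'rV[R]_n}) : {set 'rV[R]_n} :=
  [set y : 'rV[R]_n | [forall (x | x \in P), y *m x^T == 0]].

Lemma represents_sub k l n (X : 'M[R]_(k, n)) (Y : 'M[R]_(l, n)) V :
  represents X V -> (forall i, row i Y \in V) ->
  exists C : 'M[R]_(l, k), Y = C *m X.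
Proof.
case/and3P=> _ _ /eqP-> YV.
have {}YV i : exists u : 'rV[R]_k, row i Y == u *m X.
  by have /imsetP[u _ ->] := YV i; exists u.
exists (\matrix_i xchoose (YV i)); apply/row_matrixP => i.
by rewrite row_mul rowK; apply/eqP/(xchooseP (YV i)).
Qed.

Lemma represents_row k n (X : 'M[R]_(k, n)) V i :
  represents X V -> row i X \in V.
Proof.
move=> /and3P[_ _ /eqP->]; apply/imsetP.
by exists (delta_mx 0 i); rewrite -?rowE.
Qed.

Lemma dim_represents k n (X : 'M[R]_(k, n)) V : represents X V -> dim V = k.
Proof.
move=> XV; apply/eqP; rewrite eqn_leq; apply/andP; split.
  apply/bigmax_leqP => S /andP[SV /existsP[N /eqP SN]].
  have [|C SC] := @represents_sub _ _ _ _ (set_mx S) _ XV.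
    by move=> i; rewrite rowK (subsetP SV) ?enum_valP.
  by apply: (@mulmx1_min R _ _ C (X *m N)); rewrite mulmxA -SC.
have /existsP[N /eqP XN] : unimodular_mx X by case/andP: XV.
have rowX : injective (fun i => row i X).
  move=> i j eqX; have /(congr1 (mulmx^~ N)) := eqX.
  rewrite -!row_mul XN => /rowP/(_ i); rewrite !mxE eqxx.
  by case: eqP => // _ /eqP; rewrite oner_eq0.
set S := [set row i X | i : 'I_k].
have cardS : #|S| = k by rewrite card_imset // card_ord.
have idx (j : 'I_(#|S|)) : exists i : 'I_k, enum_val j == row i X.
  by have /imsetP[i _ ->] := enum_valP j; exists i.
pose f j := xchoose (idx j).
have fP j : enum_val j = row (f j) X by apply/eqP/(xchooseP (idx j)).
have f_inj : injective f.
  by move=> i j eqf; apply: enum_val_inj; rewrite !fP eqf.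
rewrite -{1}cardS; apply: leq_bigmax_cond; apply/andP; split.
  by apply/subsetP=> _ /imsetP[i _ ->]; apply: represents_row.
apply/existsP; exists (colsub f N); apply/eqP/matrixP => i j.
have -> : set_mx S = rowsub f X.
  by apply/row_matrixP => a; rewrite rowK fP row_rowsub.
have /matrixP/(_ (f i) (f j)) := XN; rewrite !mxE (inj_eq f_inj) => <-.
by apply: eq_bigr => a _; rewrite !mxE.
Qed.

Lemma repr_mxP k n (V : {set 'rV[R]_n}) :
  subspace k V -> represents (repr_mx V) V.
Proof.
case=> _ [X XV]; have dV := dim_represents XV; rewrite /repr_mx.
case: pickP => //= noX; case/negP: (negbT (noX (castmx (esym dV, erefl) X))).
by move: (dim V) dV => d dV; case: k / dV X XV {noX} => X; rewrite castmx_id.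
Qed.

Lemma inner_rank_mull k l n (C : 'M[R]_(k, l)) (M : 'M[R]_(l, n)) :
  (inner_rank (C *m M) <= inner_rank M)%N.
Proof.
rewrite /inner_rank; case: (ex_minnP (inner_rank_ex M)).
move=> r /existsP[A /existsP[B /eqP->]] _.
case: ex_minnP => q _; apply; apply/existsP; exists (C *m A).
by apply/existsP; exists B; rewrite mulmxA.
Qed.

Lemma adE k l n (X : 'M[R]_(k, n)) (Y : 'M[R]_(l, n)) (V W : {set 'rV[R]_n}) :
    submod_closed V -> submod_closed W -> represents X V -> represents Y W ->
  ad V W = (inner_rank (col_mx X Y))%:Z - (maxn (dim V) (dim W))%:Z.
Proof.
move=> sV sW XV YW; congr (Posz _ - _); apply/eqP.
have X'V : represents (repr_mx V) V by apply: (@repr_mxP k); split=> //; exists X.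
have Y'W : represents (repr_mx W) W by apply: (@repr_mxP l); split=> //; exists Y.
have le_rank k1 l1 k2 l2 (X1 : 'M_(k1, n)) (Y1 : 'M_(l1, n)) (X2 : 'M_(k2, n))
    (Y2 : 'M_(l2, n)) :
    represents X1 V -> represents Y1 W -> represents X2 V -> represents Y2 W ->
    (inner_rank (col_mx X1 Y1) <= inner_rank (col_mx X2 Y2))%N.
  move=> X1V Y1W X2V Y2W.
  have [C ->] := represents_sub X2V (fun i => represents_row i X1V).
  have [D ->] := represents_sub Y2W (fun i => represents_row i Y1W).
  have -> : col_mx (C *m X2) (D *m Y2) = block_mx C 0 0 D *m col_mx X2 Y2.
    by rewrite mul_block_col !mul0mx addr0 add0r.
  exact: inner_rank_mull.
by rewrite eqn_leq !le_rank.
Qed.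

End Defs.

(* Main.v *)
Require Import Defs.
From mathcomp Require Import all_boot all_order all_algebra.
From mathcomp Require Import perm.

(** Over a local ring every right-invertible matrix [X] can be completed to an
    invertible one, so [X *m (N | N') = (1 | 0)] for some invertible [(N | N')],
    and the rows of [N'^T] form a basis of the dual of the row space of [X].
    Let [(M | M')], with inverse [(Y / Y')], play the same role for [Y].  Then
    - [(X / Y) *m (N | N') = (1, 0 / Y N, Y N')], and
    - [(Y / Y') *m (N' | M') = (Y N', 0 / Y' N', 1)].
    Splitting an identity block off lowers the inner rank by its size, hence
    both arithmetic distances are equal to the inner rank of [Y N']. *)

Set Implicit Arguments.
Unset Strict Implicit.
Unset Printing Implicit Defensive.

Import GRing.Theory.
Local Open Scope ring_scope.

(** * Locality of the residue ring *)

Definition local_ring (R : unitRingType) : Prop :=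
  forall x y : R, x + y \is a GRing.unit ->
    x \is a GRing.unit \/ y \is a GRing.unit.

(** The units are the residues prime to [p], and reduction modulo [p ^ s] preserves divisibility by
    [p] since [0 < s]. *)
Lemma prime_power_Zp_local p s : prime p -> (0 < s)%N -> local_ring 'Z_(p ^ s).
Proof.
move=> p_pr s_gt0 x y.
have q_gt1 : (1 < p ^ s)%N by rewrite -(exp1n s) ltn_exp2r // prime_gt1.
have unitE (z : 'Z_(p ^ s)) : (z \is a GRing.unit) = ~~ (p %| z)%N.
  by rewrite -[z in LHS]natr_Zp unitZpE // coprime_pexpl // prime_coprime.
have dvdD : (p %| x)%N -> (p %| (x + y)%R)%N = (p %| y)%N.
  move=> px; rewrite /= /dvdn modn_dvdm; last by rewrite Zp_cast ?dvdn_exp.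
  exact: dvdn_addr.
rewrite !unitE; case: (boolP (p %| x)%N) => [px|]; last by left.
by rewrite dvdD //; right.
Qed.

(** * Inner rank over finite commutative rings *)

Section InnerRank.
Variable R : finComNzRingType.

Lemma inner_rank_le k r n (C : 'M[R]_(k, r)) (D : 'M[R]_(r, n)) :
  (inner_rank (C *m D) <= r)%N.
Proof.
rewrite /inner_rank; case: ex_minnP => q _; apply.
by apply/existsP; exists C; apply/existsP; exists D.
Qed.

Lemma inner_rank_factor k n (M : 'M[R]_(k, n)) :
  exists C : 'M[R]_(k, inner_rank M), exists D, M = C *m D.
Proof.
rewrite /inner_rank; case: ex_minnP => r /existsP[C /existsP[D /eqP->]] _.
by exists C, D.
Qed.

Lemma inner_rank_tr k n (M : 'M[R]_(k, n)) : inner_rank M^T = inner_rank M.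
Proof.
have le_tr a b (N : 'M[R]_(a, b)) : (inner_rank N^T <= inner_rank N)%N.
  have [C [D defN]] := inner_rank_factor N.
  by rewrite [in X in (X <= _)%N]defN trmx_mul inner_rank_le.
by apply/eqP; rewrite eqn_leq le_tr -{1}[M]trmxK le_tr.
Qed.

Lemma inner_rank_mul_linv k l n (G : 'M[R]_(k, l)) H (M : 'M[R]_(l, n)) :
  H *m G = 1%:M -> inner_rank (G *m M) = inner_rank M.
Proof.
move=> HG; apply/eqP; rewrite eqn_leq inner_rank_mull /=.
by rewrite -{1}[M]mul1mx -HG -mulmxA inner_rank_mull.
Qed.

Lemma inner_rank_mul_rinv k l n (M : 'M[R]_(k, l)) (G : 'M[R]_(l, n)) H :
  G *m H = 1%:M -> inner_rank (M *m G) = inner_rank M.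
Proof.
move=> GH; rewrite -inner_rank_tr trmx_mul (@inner_rank_mul_linv _ _ _ _ H^T).
  exact: inner_rank_tr.
by rewrite -trmx_mul GH trmx1.
Qed.

End InnerRank.

(** * Unimodular matrices and block ranks over a local ring *)

Section Local.
Variables (R : finComUnitRingType) (localR : local_ring R).

Lemma local_sum_unit (I : finType) (F : I -> R) :
  \sum_i F i \is a GRing.unit -> exists i, F i \is a GRing.unit.
Proof.
elim/big_ind: _ => [|x y IHx IHy /localR[]|i _ Fi]; rewrite ?unitr0 //.
by exists i.
Qed.

(** The products [x 0 j * N j 0] sum to [1], so by locality some entry of [x] is a unit and can
    serve as pivot. *)
Lemma unimodular_row_reduce n (x : 'rV[R]_(1 + n)) N :
  x *m N = 1%:M -> exists2 G, G \in unitmx & x *m G = row_mx 1%:M 0.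
Proof.
move=> xN; have [j xj] : exists j, x 0 j \is a GRing.unit.
  have /(@local_sum_unit _)[j] : \sum_j x 0 j * N j 0 \is a GRing.unit.
    by move/matrixP/(_ 0 0): xN; rewrite !mxE => ->; apply: unitr1.
  by rewrite unitrM => /andP[xj _]; exists j.
set x' := x *m tperm_mx j 0; pose u := lsubmx x'; pose y := rsubmx x'.
have u_unit : u \in unitmx.
  rewrite unitmxE det_mx11 /u /x' -xcolE !mxE.
  suff -> : tperm j 0 (lshift n 0) = j by [].
  by rewrite (_ : lshift n 0 = 0) ?tpermR //; apply: val_inj.
(* After the swap, the block factor scales the pivot [u] to [1] and clears [y]. *)
exists (tperm_mx j 0 *m block_mx (invmx u) (- (invmx u *m y)) 0 1%:M).
  rewrite unitmx_mul unitmx_perm unitmxE det_ublock det1 mulr1.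
  by rewrite -unitmxE unitmx_inv.
rewrite mulmxA -/x' -[x']hsubmxK -/u -/y mul_row_block !mulmx0 mulmx1 addr0.
by rewrite mulmxV // mulmxN mulmxA mulmxV // mul1mx addNr.
Qed.

(** [X *m b] is the top block of [invmx G *m b], so when it vanishes only the last [l] columns of
    [G] contribute to [b]. *)
Lemma rsubmx_dsubmx_ker k l n (X : 'M[R]_(k, k + l)) G (b : 'M[R]_(k + l, n)) :
    G \in unitmx -> X *m G = row_mx 1%:M 0 -> X *m b = 0 ->
  b = rsubmx G *m (dsubmx (invmx G) *m b).
Proof.
move=> Gu XG Xb; have Xb' : usubmx (invmx G *m b) = 0.
  have : X *m G *m (invmx G *m b) = 0 by rewrite mulmxA mulmxK.
  by rewrite XG -{1}[invmx G *m b]vsubmxK mul_row_col mul1mx mul0mx addr0.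
rewrite -[LHS](mulKVmx Gu) mul_dsub_mx -[invmx G *m b in LHS]vsubmxK Xb'.
by rewrite -{1}[G]hsubmxK mul_row_col mulmx0 add0r.
Qed.

(** Gaussian elimination by columns, by induction on the number of rows. The target [pid_mx k] makes
    sense for every [n], with no splitting [k + l] to maintain. *)
Lemma unimodular_pid k n (X : 'M[R]_(k, n)) N :
  X *m N = 1%:M -> exists2 G, G \in unitmx & X *m G = pid_mx k.
Proof.
elim: k n X N => [|k IHk] n X N XN.
  by exists 1%:M; [apply: unitmx1 | rewrite [LHS]flatmx0 [RHS]flatmx0].
have := mulmx1_min XN; case: n => // n in X N XN * => _.
rewrite -[k.+1]/(1 + k)%N -[n.+1]/(1 + n)%N in X N XN *.
move: XN; rewrite -[X]vsubmxK -[N]hsubmxK mul_col_row [1%:M]scalar_mx_block.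
move: (usubmx X) (dsubmx X) (lsubmx N) (rsubmx N) => x Y a b.
case/eq_block_mx => xa xb _ Yb.
have [G Gu xG] := unimodular_row_reduce xa.
pose c := lsubmx (Y *m G); pose Z := rsubmx (Y *m G).
(* As [x *m b = 0], [b] factors through [rsubmx G]; hence [Y *m b = 1] yields a right inverse of
   [Z]. *)
have Zf : Z *m (dsubmx (invmx G) *m b) = 1%:M.
  by rewrite /Z -mulmx_rsub -mulmxA -(rsubmx_dsubmx_ker Gu xG xb).
have [H Hu ZH] := IHk _ _ _ Zf; have le_kn := mulmx1_min Zf.
(* [G] reduces the first row, [H] reduces [Z] to [pid_mx k], and the last factor clears the column
   [c] below the pivot. *)
exists (G *m (block_mx 1%:M 0 0 H *m block_mx 1%:M 0 (- (pid_mx k *m c)) 1%:M)).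
  rewrite !unitmx_mul Gu !unitmxE !det_lblock !det1 !mul1r -unitmxE Hu.
  by rewrite unitr1.
rewrite !mulmxA mul_col_mx xG -[Y *m G]hsubmxK -/c -/Z -block_mxEv.
rewrite !mulmx_block !(mulmx0, mul0mx, mulmx1, mul1mx, addr0, add0r) ZH.
rewrite mulmxN mulmxA pid_mx_id ?pid_mx_1 // mul1mx subrr.
apply/matrixP => i j; rewrite !mxE.
by case: split_ordP => i' ->; rewrite !mxE; case: split_ordP => j' ->;
  rewrite !mxE ?ord1.
Qed.

(* [invmx G] is the completion of [X]. *)
Lemma unimodular_completion k l (X : 'M[R]_(k, k + l)) N :
  X *m N = 1%:M -> exists2 G, G \in unitmx & X *m G = row_mx 1%:M 0.
Proof. by rewrite -pid_mx_row; apply: unimodular_pid. Qed.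

Lemma inner_rank_block k a b (c : 'M[R]_(a, k)) (M : 'M[R]_(a, b)) :
  inner_rank (block_mx 1%:M 0 c M) = (k + inner_rank M)%N.
Proof.
apply/eqP; rewrite eqn_leq; apply/andP; split.
  have [C [D defM]] := inner_rank_factor M.
  suff -> : block_mx 1%:M 0 c M = block_mx 1%:M 0 c C *m block_mx 1%:M 0 0 D.
    exact: inner_rank_le.
  by rewrite mulmx_block !(mulmx0, mul0mx, mulmx1, addr0, add0r) -defM.
have [C [D]] := inner_rank_factor (block_mx 1%:M 0 c M).
move: (inner_rank _) C D => r C D.
rewrite -[C]vsubmxK -[D]hsubmxK mul_col_row => /eq_block_mx[].
move: (usubmx C) (dsubmx C) (lsubmx D) (rsubmx D) => C1 C2 D1 D2.
move/esym=> C1D1 /esym C1D2 _ ->; have le_kr := mulmx1_min C1D1.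
(* Here [C1] is unimodular and kills [D2], so [D2], and with it [M = C2 *m D2], factors through
   [r - k] columns. *)
move: C1 C2 D1 D2 C1D1 C1D2; rewrite -(subnKC le_kr) => C1 C2 D1 D2 C1D1 C1D2.
have [G Gu C1G] := unimodular_completion C1D1; rewrite leq_add2l.
by rewrite (rsubmx_dsubmx_ker Gu C1G C1D2) mulmxA inner_rank_le.
Qed.

Lemma inner_rank_block_dr k a b (c : 'M[R]_(k, b)) (M : 'M[R]_(a, b)) :
  inner_rank (block_mx M 0 c 1%:M) = (k + inner_rank M)%N.
Proof.
(* Exchanging block rows and block columns, then transposing, moves the identity block to the upper
   left. *)
pose swap a b : 'M[R]_(a + b, b + a) := block_mx 0 1%:M 1%:M 0.
have swapK d e : swap d e *m swap e d = 1%:M.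
  rewrite mulmx_block !(mulmx0, mul0mx, mulmx1, addr0, add0r).
  by rewrite -scalar_mx_block.
rewrite -(inner_rank_mul_linv _ (swapK a k)) -(inner_rank_mul_rinv _ (swapK b k)).
rewrite !mulmx_block !(mulmx0, mul0mx, mulmx1, mul1mx, addr0, add0r).
rewrite -inner_rank_tr tr_block_mx trmx1 trmx0 inner_rank_block.
by rewrite inner_rank_tr.
Qed.

End Local.

(** * Duals and arithmetic distance *)

Lemma dual_submod_closed (R : finComNzRingType) n (V : {set 'rV[R]_n}) :
  submod_closed (dual V).
Proof.
split=> [|a u v]; first by rewrite inE; apply/forall_inP => x _; rewrite mul0mx.
rewrite !inE => /forall_inP uV /forall_inP vV; apply/forall_inP => x xV.
by rewrite mulmxDl -scalemxAl (eqP (uV x xV)) (eqP (vV x xV)) scaler0 addr0.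
Qed.

(** The dual is the transposed kernel of [X], spanned by the last [l] columns of [G];
    [dsubmx (invmx G)] is a left inverse of these. *)
Lemma represents_dual (R : finComUnitRingType) k l (X : 'M[R]_(k, k + l)) V G :
    represents X V -> G \in unitmx -> X *m G = row_mx 1%:M 0 ->
  represents (rsubmx G)^T (dual V).
Proof.
move=> XV Gu XG; have /and3P[_ _ /eqP defV] := XV.
have XGr : X *m rsubmx G = 0 by rewrite mulmx_rsub XG row_mxKr.
have GdGr : dsubmx (invmx G) *m rsubmx G = 1%:M.
  rewrite mulmx_rsub mul_dsub_mx mulVmx // scalar_mx_block.
  by rewrite block_mxEv col_mxKd row_mxKr.
have GrGd : (rsubmx G)^T *m (dsubmx (invmx G))^T = 1%:M.
  by rewrite -trmx_mul GdGr trmx1.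
apply/and3P; split.
- by apply/existsP; exists (dsubmx (invmx G))^T; apply/eqP.
- apply/injectiveP => u v /(congr1 (mulmx^~ (dsubmx (invmx G))^T)).
  by rewrite -!mulmxA GrGd !mulmx1.
apply/eqP/setP => y; rewrite inE; apply/forall_inP/imsetP => [yV | [u _ ->] x].
  have Xy : X *m y^T = 0.
    apply/row_matrixP => i; rewrite row_mul row0 -[LHS]trmxK trmx_mul trmxK.
    by rewrite (eqP (yV _ (represents_row i XV))) trmx0.
  exists (dsubmx (invmx G) *m y^T)^T => //.
  by apply: trmx_inj; rewrite trmx_mul !trmxK -(rsubmx_dsubmx_ker Gu XG Xy).
rewrite defV => /imsetP[v _ ->]; rewrite trmx_mul mulmxA -(mulmxA u).
by rewrite -trmx_mul XGr trmx0 mulmx0 mul0mx.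
Qed.

Lemma ad_dual_local (R : finComUnitRingType) m l (A B : {set 'rV[R]_(m + l)}) :
  local_ring R -> subspace m A -> subspace m B -> ad A B = ad (dual A) (dual B).
Proof.
move=> localR [sA [X XA]] [sB [Y YB]].
have [/existsP[X' /eqP XX'] _] := andP XA.
have [/existsP[Y' /eqP YY'] _] := andP YB.
have [G Gu XG] := unimodular_completion localR XX'.
have [H Hu YH] := unimodular_completion localR YY'.
have YE : Y = usubmx (invmx H).
  rewrite -[Y](mulmxK Hu) YH -{1}[invmx H]vsubmxK mul_row_col mul1mx mul0mx.
  exact: addr0.
have UA := represents_dual XA Gu XG; have VB := represents_dual YB Hu YH.
have sdual := @dual_submod_closed R (m + l).
rewrite (adE sA sB XA YB) (adE (sdual A) (sdual B) UA VB).
rewrite (dim_represents XA) (dim_represents YB) (dim_represents UA).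
rewrite (dim_represents VB) !maxnn.
have -> : inner_rank (col_mx X Y) = (m + inner_rank (Y *m rsubmx G))%N.
  rewrite -(inner_rank_mul_rinv _ (mulmxV Gu)) mul_col_mx XG -[Y *m G]hsubmxK.
  by rewrite -block_mxEv inner_rank_block // mulmx_rsub.
(* Transposing gives [row_mx (rsubmx G) (rsubmx H)]; multiplying it by [invmx H], whose top block is
   [Y], exposes [Y *m rsubmx G] beside an identity block of size [l]. *)
have -> : inner_rank (col_mx (rsubmx G)^T (rsubmx H)^T)
          = (l + inner_rank (Y *m rsubmx G))%N.
  rewrite -tr_row_mx inner_rank_tr -(inner_rank_mul_linv _ (mulmxV Hu)).
  have -> : rsubmx H = H *m col_mx 0 1%:M.
    by rewrite -[H in H *m _]hsubmxK mul_row_col mulmx0 mulmx1 add0r.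
  rewrite mul_mx_row mulKmx // -[invmx H *m _]vsubmxK -block_mxEh.
  by rewrite inner_rank_block_dr // -mul_usub_mx -YE.
by rewrite !PoszD [Posz m + _]addrC [Posz l + _]addrC !addrK.
Qed.

Theorem theorem3p9 (p s n m : nat) (p_prime : prime p) (s_ge1 : (1 <= s)%N)
    (m_lt_n : (m < n)%N) (A B : {set 'rV['Z_(p ^ s)]_n})
    (subA : subspace m A) (subB : subspace m B) :
  ad A B = ad (dual A) (dual B).
Proof.
(* Writing [n] as [m + (n - m)] makes [l = n - m] the dimension of the duals. *)
move: A B subA subB; rewrite -(subnKC (ltnW m_lt_n)) => A B.
exact/ad_dual_local/prime_power_Zp_local.
Qed.
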